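(* Let $\mathcal{H}$ be a separable complex Hilbert space, let $A, B \in L(\mathcal{H})$ have closed range, let $C \in L(\mathcal{H})$ and let $W \in L(\mathcal{H})^{+}$. For $X\in L(\mathcal{H})$ put $H(X)=(AXB-C)^{*}W(AXB-C)$. Then the following conditions are equivalent: \begin{enumerate} \item[i)] The set $\{H(X): X \in L(\mathcal{H})\}$ has a minimum, i.e., there exists $X_0 \in L(\mathcal{H})$ such that $H(X) \geq H(X_0)$ for every $X \in L(\mathcal{H})$. \item[ii)] $R(C) \subseteq R(A) + R(A)^{\perp_{W}}$ and $N(B) \subseteq N(A^*WC)$. \item[iii)] The normal equation $A^*W(AXB-C)=0$ admits a solution $X\in L(\mathcal{H})$. \end{enumerate} If any of these conditions holds, then $$\min_{X \in L(\mathcal{H})} H(X)=C^{*}W_{/R(A)}C.$$ Moreover, in this case, an operator $X_0 \in L(\mathcal{H})$ satisfies $\min_{X \in L(\mathcal{H})} H(X)=H(X_0)$ if and only if $X_0B$ is a $W$-inverse of $A$ in $R(C)$.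
   Context: $L(\mathcal{H})$ is the algebra of bounded linear operators on $\mathcal{H}$ and $L(\mathcal{H})^{+}$ is the cone of positive semidefinite operators. $R(T)$ and $N(T)$ denote the range and the nullspace of $T$. Order: $S\le T$ if $T-S\in L(\mathcal{H})^{+}$; the minimum is with respect to this order. For $W\in L(\mathcal{H})^{+}$, the associated seminorm is $\Vert x\Vert_W=\langle Wx,x\rangle^{1/2}$, and the $W$-orthogonal complement of $\mathcal{S}\subseteq\mathcal{H}$ is $\mathcal{S}^{\perp_W}=\{x\in\mathcal{H}:\langle Wx,y\rangle=0 \text{ for all } y\in \mathcal{S}\}=W^{-1}(\mathcal{S}^\perp)$. Given $A$ with closed range and $C\in L(\mathcal{H})$, an operator $G\in L(\mathcal{H})$ is a $W$-inverse of $A$ in $R(C)$ if $\Vert AGx-Cx\Vert_W\le \Vert Az-Cx\Vert_W$ for every $x,z\in\mathcal{H}$. For a closed subspace $\mathcal{S}\subseteq \mathcal{H}$, the shorted operator of $W$ to $\mathcal{S}$ is $W_{/\mathcal{S}}=\max \{ X \in L(\mathcal{H}): 0\leq X\leq W \mbox{ and } R(X)\subseteq \mathcal{S}^{\perp}\}$ (it is known that this maximum always exists).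
   Formalization: It is additionally assumed that B is not the zero operator: for B = 0 the operator H(X) = C*WC is constant, so i) always holds, while ii) and iii) both say A*WC = 0 and fail e.g. for A = C = W = I. *)

(* Defs.v *)
From HB Require Import structures.
From mathcomp Require Import all_boot all_order all_algebra.
From mathcomp Require Import complex.
From mathcomp Require Import all_classical all_reals all_analysis.

Set Implicit Arguments.
Unset Strict Implicit.
Unset Printing Implicit Defensive.

Import Order.TTheory GRing.Theory Num.Theory numFieldNormedType.Exports.

Local Open Scope classical_set_scope.
Local Open Scope ring_scope.

(* A complex Hilbert space: a Banach space over R[i] whose norm comes from an
   inner product, linear in its first argument and conjugate-linear in its
   second one. Norms and inner products take their values in R[i], in which
   [0 <= z] means that z is real and nonnegative. *)
HB.mixin Record CompleteNormedModule_isHilbert (R : realType) H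
    of CompleteNormedModule R[i] H := {
  inner : {dot H for (@Num.conj R[i])} ;
  inner_norm : forall x : H, inner x x = `|x| ^+ 2 }.

#[short(type="hilbertType")]
HB.structure Definition Hilbert (R : realType) :=
  { H of CompleteNormedModule R[i] H & CompleteNormedModule_isHilbert R H }.

Definition separable (T : topologicalType) : Prop :=
  exists2 D : set T, countable D & dense D.

Section Operators.
Context {R : realType} {H : hilbertType R}.
Implicit Types (A C G S T W X : H -> H) (U : set H) (E : set (H -> H)).

Definition bounded_ops : set (H -> H) :=
  [set T | linear T /\ exists M : R[i], forall x, `|T x| <= M * `|x|].

Definition nullspace T : set H := T @^-1` [set 0].

(* The adjoint of a bounded operator exists (and is unique) by the Riesz
   representation theorem, so that the default value is not used on
   [bounded_ops]. *)
Definition adjoint T : H -> H :=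
  xget (cst 0) [set S | bounded_ops S /\
                        forall x y, inner (T x) y = inner x (S y)].

Definition psd_ops : set (H -> H) :=
  [set T | bounded_ops T /\ forall x, 0 <= inner (T x) x].

Definition op_le S T : Prop := psd_ops (T \- S).

Definition is_min_op E T : Prop := E T /\ forall S, E S -> op_le T S.

Definition is_max_op E T : Prop := E T /\ forall S, E S -> op_le S T.

Definition wnorm W (x : H) : R[i] := sqrtC (inner (W x) x).

Definition orthogonal_compl U : set H :=
  [set x | forall y, U y -> inner x y = 0].

Definition worthogonal_compl W U : set H :=
  [set x | forall y, U y -> inner (W x) y = 0].

Definition set_add (U V : set H) : set H := [set u + v | u in U & v in V].

Definition is_winverse W A C G : Prop :=
  bounded_ops G /\
  forall x z, wnorm W (A (G x) - C x) <= wnorm W (A z - C x).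

(* The maximum exists whenever W is positive semidefinite and U is a closed
   subspace, so that the default value is not used in that case. *)
Definition shorted W U : H -> H :=
  xget (cst 0)
    (is_max_op [set X | [/\ bounded_ops X, op_le (cst 0) X, op_le X W
                          & range X `<=` orthogonal_compl U]]).

End Operators.

(* Main.v *)
Require Import Defs.
From HB Require Import structures.
From mathcomp Require Import all_boot all_order all_algebra.
From mathcomp Require Import complex ring lra.
From mathcomp Require Import all_classical all_reals all_analysis.

(* Write [<x, y>_W = <W x, y>] and [S = R(A)]. Since [B <> 0], minimality of
   [H(X)] among all [X] amounts to minimality of [|A X B x - C x|_W] among all
   [|A z - C x|_W], for each [x], that is to [W (A X B x - C x)] being
   orthogonal to [S]: the normal equation. It is solvable if and only if [A^* W C] factors
   as [A^* W A G] with [G] bounded and vanishes on [N(B)]; the first condition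
   reduces to an inclusion of ranges by Douglas' lemma, and a bounded right
   inverse of [B] on its closed range turns [G] into a solution [X].

   The shorted operator maps [x] to the limit of [W (x + s_n)], where [s_n] is
   a sequence in [S] that minimizes [|x + s_n|_W]. When [X] solves the normal
   equation, [s = - A X B x] attains the minimum for [C x], so that
   [W_{/S} C = W (C - A X B)], whence the value of the minimum. For [W = 1] the
   same construction gives the orthogonal projections, and then Riesz'
   representation theorem. *)

Set Implicit Arguments.
Unset Strict Implicit.
Unset Printing Implicit Defensive.

Import Order.TTheory GRing.Theory Num.Theory numFieldNormedType.Exports.

Local Open Scope classical_set_scope.
Local Open Scope ring_scope.

(** * Real-valued norms, limits and closed sets *)

Local Notation re := complex.Re.
Local Notation "x %:C" := (real_complex _ x) : ring_scope.

(* The norm as a real number, so that [lra] and [nra] apply. *)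
Definition rnorm (R : realType) (V : normedZmodType R[i]) (x : V) : R :=
  re `|x|.

Section RealNorm.
Context {R : realType}.

Lemma reD (a b : R[i]) : re (a + b) = re a + re b.
Proof. by case: a b => [? ?] []. Qed.

Lemma reN (a : R[i]) : re (- a) = - re a.
Proof. by case: a. Qed.

Lemma re_conj (a : R[i]) : re a^* = re a.
Proof. by case: a. Qed.

Lemma conj_realC (r : R) : (r%:C)^* = r%:C.
Proof. exact: conjc_real. Qed.

Lemma ge0_complexE (a : R[i]) : 0 <= a -> a = (re a)%:C.
Proof. by move=> a0; rewrite RRe_real// ger0_real. Qed.

Lemma ge0_re (a : R[i]) : 0 <= a -> 0 <= re a.
Proof. by rewrite lecE => /andP[]. Qed.

Section Zmod.
Context {V : normedZmodType R[i]}.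
Implicit Types x y : V.

Lemma rnormE x : `|x| = (rnorm x)%:C.
Proof. exact: ge0_complexE. Qed.

Lemma rnorm_ge0 x : 0 <= rnorm x.
Proof. exact: ge0_re. Qed.

Lemma rnormN x : rnorm (- x) = rnorm x.
Proof. by rewrite /rnorm normrN. Qed.

Lemma rnormBC x y : rnorm (x - y) = rnorm (y - x).
Proof. by rewrite /rnorm distrC. Qed.

Lemma rnormD x y : rnorm (x + y) <= rnorm x + rnorm y.
Proof. by have := ler_normD x y; rewrite !rnormE -rmorphD lecR. Qed.

Lemma rnorm0 : rnorm (0 : V) = 0.
Proof. by rewrite /rnorm normr0. Qed.

Lemma rnorm_eq0 x : rnorm x = 0 -> x = 0.
Proof. by move=> x0; apply/eqP; rewrite -normr_eq0 rnormE x0. Qed.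

End Zmod.

Lemma rnormZ (V : normedModType R[i]) (a : R[i]) (x : V) :
  rnorm (a *: x) = rnorm a * rnorm x.
Proof. by rewrite {1}/rnorm normrZ !rnormE -rmorphM. Qed.

Lemma rnormM (a b : R[i]) : rnorm (a * b) = rnorm a * rnorm b.
Proof. by rewrite {1}/rnorm normrM !rnormE -rmorphM. Qed.

Lemma rnorm_conj (a : R[i]) : rnorm a^* = rnorm a.
Proof. by rewrite /rnorm norm_conjC. Qed.

Lemma rnorm_real (r : R) : rnorm r%:C = `|r|.
Proof. by rewrite /rnorm normc_def /= expr0n addr0 sqrtr_sqr. Qed.

Lemma normr_re_le (a : R[i]) : `|re a| <= rnorm a.
Proof. by rewrite -lecR -rnormE normc_ge_Re. Qed.

Lemma normr_im_le (a : R[i]) : `|complex.Im a| <= rnorm a.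
Proof.
have := normr_re_le (a * 'i); rewrite ReiNIm normrN rnormM.
by rewrite {2}/rnorm normCi mulr1.
Qed.

Lemma re_le_rnorm (a : R[i]) : re a <= rnorm a.
Proof. exact: le_trans (ler_norm _) (normr_re_le a). Qed.

Lemma sqr_rnorm (a : R[i]) : (rnorm a ^+ 2)%:C = a * a^*.
Proof. by rewrite -normCK rnormE rmorphXn. Qed.

(** Stands for the passage to the limit [e -> 0] in estimates. Restricting to [e <= 1] lets [e ^+ 2]
    be absorbed into a multiple of [e]. *)
Lemma ler_eps_lin (a b c : R) :
  (forall e, 0 < e -> e <= 1 -> a <= b + e * c) -> a <= b.
Proof.
move=> h; rewrite leNgt; apply/negP => ba.
have c0 : 0 < c.
  rewrite ltNge; apply/negP => c0.
  by have := h 1 ltr01 (lexx _); lra.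
pose d := Num.min 1 ((a - b) / (2 * c)).
have d0 : 0 < d by rewrite lt_min ltr01 divr_gt0//; nra.
have d1 : d <= 1 by rewrite ge_min lexx.
have d2 : d * c <= (a - b) / 2.
  have -> : (a - b) / 2 = (a - b) / (2 * c) * c by field; lra.
  by rewrite ler_pM2r// ge_min lexx orbT.
by have := h d d0 d1; lra.
Qed.

Lemma complete_cvg_seq (V : completeNormedModType R[i]) (u : nat -> V) :
  (forall e : R, 0 < e -> exists N, forall n m,
     (N <= n)%N -> (N <= m)%N -> rnorm (u n - u m) <= e) ->
  exists l, forall e : R, 0 < e -> exists N, forall n,
     (N <= n)%N -> rnorm (u n - l) <= e.
Proof.
move=> ucau; have : cvg (u n @[n --> \oo]).
  apply/cauchy_cvgP/cauchy_ballP => e e0.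
  (* The radius [e] lives in [R[i]]; being positive, it is real. Halving it yields the strict
     inequality that balls require. *)
  have eE := ge0_complexE (ltW e0).
  have e1 : 0 < re e / 2.
    by rewrite divr_gt0// -ltcR -eE.
  have [N hN] := ucau _ e1.
  exists ([set u n | n in [set n | (N <= n)%N]],
          [set u n | n in [set n | (N <= n)%N]]) => /=.
    by split; exists N => // n /= Nn; exists n.
  move=> [x y] /= [[n Nn <-] [m Nm <-]].
  rewrite -ball_normE /= rnormE eE ltcR.
  by have := hN n m Nn Nm; lra.
move=> /cvg_ex[l /cvgrPdist_le ul]; exists l => e e0.
have [|N _ hN] := ul e%:C; first by rewrite (ltcR 0).
exists N => n Nn; have := hN n Nn.
by rewrite /= rnormE lecR rnormBC.
Qed.

Lemma closed_approx (V : normedModType R[i]) (S : set V) x :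
  closed S -> (forall e : R, 0 < e -> exists2 s, S s & rnorm (x - s) <= e) ->
  S x.
Proof.
move=> clS h; apply: clS => B /nbhs_ballP[e /= e0 eB].
have eE := ge0_complexE (ltW e0).
have e1 : 0 < re e / 2 by rewrite divr_gt0// -ltcR -eE.
have [s Ss xs] := h _ e1; exists s; split=> //; apply: eB.
by rewrite -ball_normE /= rnormE eE ltcR; lra.
Qed.

End RealNorm.

(** * Linear maps as bare functions *)

Section Linear.
Context {R : realType} {U V : lmodType R[i]} (f : U -> V).
Hypothesis lf : linear f.

Let g : {linear U -> V} := HB.pack f (GRing.isLinear.Build _ _ _ _ _ lf).

Lemma lin0 : f 0 = 0. Proof. exact: (linear0 g). Qed.
Lemma linD x y : f (x + y) = f x + f y. Proof. exact: (linearD g). Qed.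
Lemma linN x : f (- x) = - f x. Proof. exact: (linearN g). Qed.
Lemma linB x y : f (x - y) = f x - f y. Proof. exact: (linearB g). Qed.
Lemma linZ a x : f (a *: x) = a *: f x. Proof. exact: (linearZ_LR g). Qed.

End Linear.

(** * Inner product calculus *)

Section InnerProduct.
Context {R : realType} {H : hilbertType R}.
Implicit Types (x y z : H) (a : R[i]).

Lemma innerDl x y z : inner (x + y) z = inner x z + inner y z.
Proof. exact: (linearDl inner). Qed.
Lemma innerNl x z : inner (- x) z = - inner x z.
Proof. exact: (linearNl inner). Qed.
Lemma innerBl x y z : inner (x - y) z = inner x z - inner y z.
Proof. exact: (linearBl inner). Qed.
Lemma innerZl a x z : inner (a *: x) z = a * inner x z.
Proof. exact: (linearZl_LR inner). Qed.
Lemma inner0l z : inner 0 z = 0.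
Proof. exact: (linear0l inner). Qed.
Lemma innerDr x y z : inner x (y + z) = inner x y + inner x z.
Proof. exact: (linearDr inner). Qed.
Lemma innerBr x y z : inner x (y - z) = inner x y - inner x z.
Proof. exact: (linearBr inner). Qed.
Lemma innerZr a x z : inner x (a *: z) = a^* * inner x z.
Proof. exact: (linearZr_LR inner). Qed.
Lemma inner0r z : inner z 0 = 0.
Proof. exact: (linear0r inner). Qed.
Lemma innerC x y : inner x y = (inner y x)^*.
Proof. by rewrite (hermC inner) mul1r. Qed.

Lemma inner_rnorm x : inner x x = (rnorm x ^+ 2)%:C.
Proof. by rewrite inner_norm rnormE rmorphXn. Qed.

Lemma inner_eq0 x : inner x x = 0 -> x = 0.
Proof.
by rewrite inner_norm => /eqP; rewrite expf_eq0 /= normr_eq0 => /eqP.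
Qed.

Lemma inner_inj x y : (forall z, inner x z = inner y z) -> x = y.
Proof.
move=> h; apply/eqP; rewrite -subr_eq0; apply/eqP/inner_eq0.
by rewrite innerBl h subrr.
Qed.

End InnerProduct.

(** * Seminorms of positive semidefinite operators *)

Section BoundedOps.
Context {R : realType} {H : hilbertType R}.
Implicit Types (S T W : H -> H) (x y t : H).

Lemma bounded_opsP T : bounded_ops T <->
  linear T /\ exists2 M : R, 0 <= M & forall x, rnorm (T x) <= M * rnorm x.
Proof.
split=> [[lT [M hM]]|[lT [M M0 hM]]]; split => //.
  exists (rnorm M); first exact: rnorm_ge0.
  move=> x; rewrite -lecR -rnormE (le_trans (hM x))//.
  (* The given bound dominates a norm, so it is real and nonnegative and equals its own norm. *)
  rewrite rmorphM /= -!rnormE -[X in _ <= _ * X]normr_id -normrM.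
  by rewrite real_ler_norm// ger0_real// (le_trans _ (hM x)).
by exists M%:C => x; rewrite !rnormE -rmorphM lecR.
Qed.

Section Hermitian.
Variable W : H -> H.
Hypotheses (lW : linear W) (pW : forall x, 0 <= inner (W x) x).

(** Polarization: [<W z, z>] is real; [z = x + y] gives the imaginary parts and [z = x + 'i *: y]
    the real parts. *)
Lemma psd_innerC x y : inner (W x) y = (inner (W y) x)^*.
Proof.
have im0 z : complex.Im (inner (W z) z) = 0.
  by have := pW z; rewrite lecE => /andP[/eqP ->].
have := im0 (x + y); have := im0 (x + 'i *: y).
rewrite !(linD lW, linZ lW, innerDl, innerDr, innerZl, innerZr).
have := im0 x; have := im0 y.
move: (inner (W x) y) (inner (W y) x) (inner (W x) x) (inner (W y) y).
move=> [a a'] [b b'] [c c'] [d d'] /= -> ->; simpc => h1 h2.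
by apply/eqP; rewrite eq_complex /=; apply/andP; split; apply/eqP; lra.
Qed.

Definition wform x : R := re (inner (W x) x).

Lemma wformE x : inner (W x) x = (wform x)%:C.
Proof. exact: ge0_complexE. Qed.

Lemma wform_ge0 x : 0 <= wform x.
Proof. exact: ge0_re. Qed.

Lemma wformD x y : wform (x + y) = wform x + 2 * re (inner (W x) y) + wform y.
Proof.
rewrite /wform (linD lW) !innerDl !innerDr !reD (psd_innerC y x) re_conj; ring.
Qed.

Lemma wformZ a x : wform (a *: x) = rnorm a ^+ 2 * wform x.
Proof.
rewrite /wform (linZ lW) innerZl innerZr mulrA -sqr_rnorm wformE -rmorphM /=.
by [].
Qed.

(* With [b = <Wx, t>] and [c = <Wt, t>], moving [x] by [- l b t] for a real
   [l >= 0] changes the form by [- 2 l |b|^2 + l^2 |b|^2 c], and [l = 1 / c] is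
   the optimal choice. *)
Lemma near_min_inner x t (e : R) :
  (forall a : R[i], wform x <= wform (x + a *: t) + e) ->
  rnorm (inner (W x) t) ^+ 2 <= e * wform t.
Proof.
move=> h; set b := inner (W x) t; set n := rnorm b ^+ 2; set c := wform t.
have n0 : 0 <= n by rewrite exprn_ge0 ?rnorm_ge0.
have c0 : 0 <= c := wform_ge0 t.
have key (l : R) : 0 <= e - 2 * l * n + l ^+ 2 * n * c.
  have := h (- (l%:C * b)); rewrite wformD wformZ rnormN rnormM rnorm_real.
  rewrite innerZr -/b -/c rmorphN rmorphM /= mulNr -mulrA [b^* * b]mulrC.
  rewrite -sqr_rnorm conj_realC -rmorphM /= -/n.
  rewrite exprMn -/n real_normK ?num_real//; lra.
have e0 : 0 <= e by have := key 0; lra.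
have [c00|c1] := eqVneq c 0.
  rewrite c00 mulr0 leNgt; apply/negP => n1.
  (* Without the quadratic term, this [l] leaves [e - 2 * (e + 1)], which is negative. *)
  have := key ((e + 1) / n); rewrite c00 mulr0 -mulrA divfK ?gt_eqF//; lra.
have {c0}c1 : 0 < c by rewrite lt_def c1.
have k := key c^-1; rewrite -subr_ge0.
have -> : e * c - n = (e - 2 * c^-1 * n + c^-1 ^+ 2 * n * c) * c by field; lra.
by rewrite mulr_ge0// ltW.
Qed.

Definition wseminorm x : R := Num.sqrt (wform x).

Lemma wseminorm_ge0 x : 0 <= wseminorm x.
Proof. exact: sqrtr_ge0. Qed.

Lemma sqr_wseminorm x : wseminorm x ^+ 2 = wform x.
Proof. by rewrite sqr_sqrtr// wform_ge0. Qed.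

(** The form being nonnegative, [x] minimizes it along any line up to the error [wform x];
    [near_min_inner] with this error is the squared inequality. *)
Lemma psd_Cauchy_Schwarz x y :
  rnorm (inner (W x) y) <= wseminorm x * wseminorm y.
Proof.
rewrite -(@ler_pXn2r _ 2)// ?nnegrE ?mulr_ge0 ?wseminorm_ge0 ?rnorm_ge0//.
rewrite exprMn !sqr_wseminorm; apply: near_min_inner => a.
by rewrite lerDr wform_ge0.
Qed.

Lemma wseminormD x y : wseminorm (x + y) <= wseminorm x + wseminorm y.
Proof.
rewrite -(@ler_pXn2r _ 2)// ?nnegrE ?addr_ge0 ?wseminorm_ge0//.
rewrite sqrrD !sqr_wseminorm wformD.
by have := le_trans (re_le_rnorm _) (psd_Cauchy_Schwarz x y); lra.
Qed.

Lemma ler_wnorm x y : (wnorm W x <= wnorm W y) = (wform x <= wform y).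
Proof. by rewrite /wnorm ler_sqrtC ?nnegrE// !wformE lecR. Qed.

End Hermitian.

Lemma rnorm_inner x y : rnorm (inner x y) <= rnorm x * rnorm y.
Proof.
have lid : linear (idfun : H -> H) by [].
have pid (z : H) : 0 <= inner (idfun z) z by rewrite inner_norm exprn_ge0.
have wseminormE (z : H) : wseminorm idfun z = rnorm z.
  rewrite /wseminorm /wform /= inner_rnorm /=.
  by rewrite sqrtr_sqr ger0_norm// rnorm_ge0.
by have := psd_Cauchy_Schwarz lid pid x y; rewrite !wseminormE.
Qed.

(** Turns seminorm estimates on [x] into norm estimates on [W x]. Cauchy-Schwarz gives
    [|W x|^2 <= |x|_W |W x|_W], and the second bound, applied to [W x], lets one factor cancel. *)
Lemma psd_bounds W : psd_ops W -> exists2 M : R, 0 <= M &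
  forall x, rnorm (W x) <= M * wseminorm W x /\ wseminorm W x <= M * rnorm x.
Proof.
move=> [/bounded_opsP[lW [M M0 hM]] pW].
have wle x : wseminorm W x <= Num.sqrt M * rnorm x.
  rewrite -(@ler_pXn2r _ 2)// ?nnegrE;
    rewrite ?mulr_ge0 ?wseminorm_ge0 ?sqrtr_ge0 ?rnorm_ge0//.
  rewrite exprMn sqr_wseminorm// sqr_sqrtr//.
  apply: le_trans (re_le_rnorm _) _; apply: le_trans (rnorm_inner _ _) _.
  by rewrite expr2 mulrA ler_wpM2r ?rnorm_ge0.
exists (Num.sqrt M); first exact: sqrtr_ge0.
move=> x; split=> //.
have [->|Wx0] := eqVneq (rnorm (W x)) 0.
  by rewrite mulr_ge0 ?sqrtr_ge0 ?wseminorm_ge0.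
have Wx1 : 0 < rnorm (W x) by rewrite lt_def Wx0 rnorm_ge0.
rewrite -(ler_pM2r Wx1) -expr2.
have := psd_Cauchy_Schwarz lW pW x (W x).
rewrite inner_rnorm rnorm_real ger0_norm ?sqr_ge0// => /le_trans; apply.
rewrite [X in _ <= X * _]mulrC -mulrA ler_wpM2l ?wseminorm_ge0//.
Qed.

End BoundedOps.

(** * Weighted projections *)

Section WeightedResidual.
Context {R : realType} {H : hilbertType R}.
Implicit Types (S : set H) (W : H -> H) (x y z s t : H).

Definition subspace S :=
  S 0 /\ forall (a : R[i]) u v, S u -> S v -> S (a *: u + v).

Lemma subspaceZ S (a : R[i]) u : subspace S -> S u -> S (a *: u).
Proof. by move=> [S0 SL] Su; rewrite -[a *: u]addr0; apply: SL. Qed.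

Lemma subspaceD S u v : subspace S -> S u -> S v -> S (u + v).
Proof. by move=> [S0 SL] Su Sv; rewrite -[u]scale1r; apply: SL. Qed.

Lemma subspaceN S u : subspace S -> S u -> S (- u).
Proof. by move=> hS Su; rewrite -scaleN1r; apply: subspaceZ. Qed.

Lemma subspaceB S u v : subspace S -> S u -> S v -> S (u - v).
Proof. by move=> hS Su Sv; apply: subspaceD => //; apply: subspaceN. Qed.

Lemma subspace_range (T : H -> H) : linear T -> subspace (range T).
Proof.
move=> lT; split => [|a _ _ [u _ <-] [v _ <-]].
  by exists 0; rewrite ?(lin0 lT).
by exists (a *: u + v); rewrite ?lT.
Qed.

Lemma subspace_ker (V : lmodType R[i]) (T : H -> V) :
  linear T -> subspace [set x | T x = 0].
Proof.
move=> lT; split; first by rewrite /= (lin0 lT).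
by move=> a u v /= Tu Tv; rewrite lT Tu Tv scaler0 addr0.
Qed.

(* In the completion of [H] for the seminorm of [W], [z] represents the
   component of [x] that is [W]-orthogonal to [S]; it is the limit of
   [W (x + s)] along those [s] in [S] for which [x + s] is nearly
   [W]-orthogonal to [S]. *)
Definition wresidual W S x z := forall e : R, 0 < e ->
  exists2 s, S s & rnorm (W (x + s) - z) <= e /\
    forall t, S t -> rnorm (inner (W (x + s)) t) <= e * wseminorm W t.

Section Theory.
Variables (W : H -> H) (S : set H).
Hypotheses (psdW : psd_ops W) (subS : subspace S).

Let lW : linear W. Proof. by case: psdW => -[]. Qed.
Let pW : forall x, 0 <= inner (W x) x. Proof. by case: psdW. Qed.

Lemma wresidual_lin (a : R[i]) x y z z' :
  wresidual W S x z -> wresidual W S y z' ->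
  wresidual W S (a *: x + y) (a *: z + z').
Proof.
move=> hx hy e e0.
have a0 : 0 < rnorm a + 1 by rewrite ltr_wpDl ?rnorm_ge0.
pose d := e / (rnorm a + 1); have d0 : 0 < d by rewrite divr_gt0.
have dE : rnorm a * d + d = e by rewrite /d; field; lra.
have [s Ss [sz so]] := hx _ d0; have [s' Ss' [sz' so']] := hy _ d0.
exists (a *: s + s'); first exact: subS.2.
have uE : W (a *: x + y + (a *: s + s')) = a *: W (x + s) + W (y + s').
  by rewrite addrACA -scalerDr (linD lW) (linZ lW).
rewrite uE; split => [|t St].
  have -> : a *: W (x + s) + W (y + s') - (a *: z + z') =
            a *: (W (x + s) - z) + (W (y + s') - z').
    by rewrite scalerBr opprD addrACA.
  apply: le_trans (rnormD _ _) _; rewrite rnormZ -dE lerD// ler_wpM2l//.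
  exact: rnorm_ge0.
rewrite innerDl innerZl; apply: le_trans (rnormD _ _) _.
rewrite rnormM -dE mulrDl lerD//; last exact: so'.
by rewrite -mulrA ler_wpM2l ?rnorm_ge0//; exact: so.
Qed.

(** Testing the near-orthogonality of [s] against [s] itself gives [|s|_W <= e], so that [W s], and
    with it [z], is of order [e]. *)
Lemma wresidual0_eq0 z : wresidual W S 0 z -> z = 0.
Proof.
move=> hz; have [M M0 hM] := psd_bounds psdW.
apply: rnorm_eq0; apply/eqP; rewrite eq_le rnorm_ge0 andbT.
apply: (@ler_eps_lin _ _ _ (1 + M)) => e e0 _.
have [s Ss] := hz e e0; rewrite add0r => -[sz so].
have ws : wseminorm W s <= e.
  have := so s Ss; rewrite wformE// rnorm_real ger0_norm ?wform_ge0//.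
  rewrite -sqr_wseminorm// expr2 => h; rewrite leNgt; apply/negP => es.
  by have := lt_trans e0 es => w0; rewrite ler_pM2r// leNgt es in h.
have -> : z = W s - (W s - z) by rewrite opprB addrC subrK.
apply: le_trans (rnormD _ _) _; rewrite rnormN.
have := (hM s).1; have : M * wseminorm W s <= M * e by rewrite ler_wpM2l.
by lra.
Qed.

Lemma wresidual_uniq x z z' : wresidual W S x z -> wresidual W S x z' -> z = z'.
Proof.
move=> hz hz'; have := wresidual_lin (-1) hz hz'.
rewrite !scaleN1r addNr => /wresidual0_eq0/eqP.
by rewrite addrC subr_eq0 => /eqP.
Qed.

(** Where the minimum is attained, one [s] serves for every [e]. *)
Lemma wresidual_exact x s :
  S s -> (forall t, S t -> inner (W (x + s)) t = 0) ->
  wresidual W S x (W (x + s)).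
Proof.
move=> Ss so e e0; exists s => //; split; first by rewrite subrr rnorm0 ltW.
by move=> t St; rewrite so// rnorm0 mulr_ge0 ?wseminorm_ge0// ltW.
Qed.

Lemma wresidual_orth x z t : wresidual W S x z -> S t -> inner z t = 0.
Proof.
move=> hz St; apply: rnorm_eq0; apply/eqP; rewrite eq_le rnorm_ge0 andbT.
apply: (@ler_eps_lin _ _ _ (rnorm t + wseminorm W t)) => e e0 _.
have [s Ss [sz so]] := hz e e0.
have -> : z = W (x + s) - (W (x + s) - z) by rewrite opprB addrC subrK.
rewrite innerBl; apply: le_trans (rnormD _ _) _; rewrite rnormN add0r.
have := so t St; have := rnorm_inner (W (x + s) - z) t.
have : rnorm (W (x + s) - z) * rnorm t <= e * rnorm t.
  by rewrite ler_wpM2r ?rnorm_ge0.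
by lra.
Qed.

(** Bound both terms of [|s|_W^2 = <W (x + s), s> - <W x, s>] and divide by [|s|_W]. *)
Lemma wseminorm_near_orth x s (e : R) : 0 <= e -> S s ->
  (forall t, S t -> rnorm (inner (W (x + s)) t) <= e * wseminorm W t) ->
  wseminorm W s <= wseminorm W x + e.
Proof.
move=> e0 Ss so; rewrite leNgt; apply/negP => ws.
have : wseminorm W s ^+ 2 <= (wseminorm W x + e) * wseminorm W s.
  rewrite sqr_wseminorm//.
  have -> : wform W s = re (inner (W (x + s)) s - inner (W x) s).
    by rewrite -innerBl -(linB lW) addrC addKr.
  apply: le_trans (re_le_rnorm _) _; apply: le_trans (rnormD _ _) _.
  by rewrite rnormN; have := so s Ss; have := psd_Cauchy_Schwarz lW pW x s; lra.
have ws0 : 0 < wseminorm W s.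
  by apply: le_lt_trans ws; rewrite addr_ge0 ?wseminorm_ge0.
by rewrite expr2 ler_pM2r// leNgt ws.
Qed.

(** [<z, x>] is close to [<W (x + s), x>], which differs from [wform W (x + s)] by [<W (x + s), s>];
    this is small since [|s|_W] is at most [|x|_W + 1]. *)
Lemma wresidual_approx x z : wresidual W S x z -> exists2 c : R, 0 <= c &
  forall e : R, 0 < e -> e <= 1 -> exists2 s, S s &
    rnorm (inner z x - (wform W (x + s))%:C) <= e * c /\
    (forall t, S t -> wform W (x + s) <= wform W (x + t) + e ^+ 2).
Proof.
move=> hz; exists (rnorm x + (wseminorm W x + 1)).
  by rewrite addr_ge0 ?rnorm_ge0// addr_ge0 ?wseminorm_ge0.
move=> e e0 e1; have [s Ss [sz so]] := hz e e0; exists s => //; split.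
  rewrite -wformE// innerDr.
  have -> : inner z x - (inner (W (x + s)) x + inner (W (x + s)) s) =
            - (inner (W (x + s) - z) x + inner (W (x + s)) s).
    by rewrite innerBl; ring.
  rewrite rnormN; apply: le_trans (rnormD _ _) _; rewrite mulrDr.
  apply: lerD.
    apply: le_trans (rnorm_inner _ _) _.
    by rewrite ler_wpM2r ?rnorm_ge0.
  apply: le_trans (so s Ss) _; rewrite ler_wpM2l ?(ltW e0)//.
  by apply: le_trans (wseminorm_near_orth (ltW e0) Ss so) _; rewrite lerD2l.
move=> t St; have Sd : S (t - s) by apply: subspaceB.
have -> : x + t = x + s + (t - s) by rewrite addrACA subrr addr0 addrC.
rewrite (wformD lW pW (x + s)) -(sqr_wseminorm pW (t - s)).
have := so _ Sd; have := normr_re_le (inner (W (x + s)) (t - s)).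
rewrite ler_norml => /andP[h _] h'.
(* Completing the square costs exactly [e ^+ 2]. *)
by have := sqr_ge0 (wseminorm W (t - s) - e); rewrite sqrrB; lra.
Qed.

Lemma wresidual_ge0 x z : wresidual W S x z -> 0 <= inner z x.
Proof.
move=> /wresidual_approx[c c0 hc]; rewrite lecE /=.
have h (e : R) (e0 : 0 < e) (e1 : e <= 1) :
    0 <= re (inner z x) + e * c /\ `|complex.Im (inner z x)| <= 0 + e * c.
  have [s Ss [hs _]] := hc e e0 e1.
  have w0 := wform_ge0 pW (x + s).
  split; last first.
    rewrite add0r; apply: le_trans hs.
    have -> : complex.Im (inner z x) =
              complex.Im (inner z x - (wform W (x + s))%:C).
      by case: (inner z x) => a b /=; rewrite subr0.
    exact: normr_im_le.
  have := le_trans (normr_re_le _) hs.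
  by rewrite reD reN /= ler_norml => /andP[]; lra.
apply/andP; split.
  rewrite -normr_eq0 eq_le normr_ge0 andbT.
  by apply: (@ler_eps_lin _ _ _ c) => e e0 e1; case: (h e e0 e1).
by apply: (@ler_eps_lin _ _ _ c) => e e0 e1; case: (h e e0 e1).
Qed.

(** With [wresidual_adherent], identifies [<z, x>] as the infimum of [wform W (x + t)] over [S], the
    variational formula for the shorted operator. *)
Lemma wresidual_le x z t :
  wresidual W S x z -> S t -> re (inner z x) <= wform W (x + t).
Proof.
move=> /wresidual_approx[c c0 hc] St.
apply: (@ler_eps_lin _ _ _ (c + 1)) => e e0 e1.
have [s Ss [hs hm]] := hc e e0 e1.
have := le_trans (re_le_rnorm _) hs; rewrite reD reN /= => h.
have := hm t St; rewrite expr2 => h'.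
have : e * e <= e * 1 by rewrite ler_wpM2l// ltW.
by lra.
Qed.

Lemma wresidual_adherent x z (e : R) : 0 < e -> wresidual W S x z ->
  exists2 s, S s & wform W (x + s) <= re (inner z x) + e.
Proof.
move=> e0 /wresidual_approx[c c0 hc].
pose d := Num.min 1 (e / (c + 1)).
have c1 : 0 < c + 1 by rewrite ltr_wpDl.
have d0 : 0 < d by rewrite lt_min ltr01 divr_gt0.
have d1 : d <= 1 by rewrite ge_min lexx.
have [s Ss [hs _]] := hc d d0 d1; exists s => //.
have := le_trans (normr_re_le _) hs; rewrite reD reN /= ler_norml => /andP[h _].
have : d * (c + 1) <= e by rewrite -ler_pdivlMr// ge_min lexx orbT.
by rewrite mulrDr mulr1; lra.
Qed.

Lemma wresidual_bound (M : R) x z : 0 <= M ->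
  (forall x,
    rnorm (W x) <= M * wseminorm W x /\ wseminorm W x <= M * rnorm x) ->
  wresidual W S x z -> rnorm z <= 2 * M ^+ 2 * rnorm x.
Proof.
move=> M0 hM hz; apply: (@ler_eps_lin _ _ _ (1 + M)) => e e0 _.
have [s Ss [sz so]] := hz e e0.
have -> : z = W (x + s) - (W (x + s) - z) by rewrite opprB addrC subrK.
apply: le_trans (rnormD _ _) _; rewrite rnormN.
have := (hM (x + s)).1.
have : M * wseminorm W (x + s) <= M * (2 * (M * rnorm x) + e).
  rewrite ler_wpM2l//; apply: le_trans (wseminormD lW pW _ _) _.
  by have := wseminorm_near_orth (ltW e0) Ss so; have := (hM x).2; lra.
by rewrite expr2; lra.
Qed.

(** Along a minimizing sequence, [|s_n - s_m|_W^2] is a difference of two inner products that are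
    small by near-orthogonality. Hence [W (x + s_n)] is Cauchy in norm, although [s_n] itself may
    diverge. *)
Lemma wresidual_exists x : exists z, wresidual W S x z.
Proof.
have [M M0 hM] := psd_bounds psdW.
pose E := [set wform W (x + s) | s in S].
have E0 : E !=set0 by exists (wform W (x + 0)), 0; case: subS.
have lbE : has_lbound E by exists 0 => _ [s _ <-]; exact: wform_ge0.
have near (n : nat) : exists s, S s /\
    forall t, S t -> rnorm (inner (W (x + s)) t) <= n.+1%:R^-1 * wseminorm W t.
  have n0 : 0 < n.+1%:R^-1 :> R by [].
  (* The slack is a square because [near_min_inner] bounds a squared inner product. *)
  have [_ [s Ss <-] hs] := inf_adherent (exprn_gt0 2 n0) (conj E0 lbE).
  exists s; split=> // t St.
  rewrite -(@ler_pXn2r _ 2)// ?nnegrE ?mulr_ge0 ?wseminorm_ge0 ?rnorm_ge0//.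
  rewrite exprMn sqr_wseminorm//; apply: near_min_inner => // a.
  apply: ltW (lt_le_trans hs _); rewrite lerD2r; apply: ge_inf => //.
  exists (s + a *: t); rewrite ?addrA//.
  by apply: subspaceD => //; exact: subspaceZ.
have [s hs] := choice near.
have close n m :
    rnorm (W (x + s n) - W (x + s m)) <= M * (n.+1%:R^-1 + m.+1%:R^-1).
  rewrite -(linB lW); apply: le_trans (hM _).1 _; rewrite ler_wpM2l//.
  have -> : x + s n - (x + s m) = s n - s m.
    by rewrite opprD addrACA subrr add0r.
  set d := s n - s m.
  have Sd : S d.
    by apply: subspaceB => //; [exact: (hs n).1|exact: (hs m).1].
  have := wseminorm_ge0 W d; rewrite le_eqVlt => /orP[/eqP <-|w0].
    by rewrite addr_ge0.
  rewrite -(ler_pM2r w0) -expr2 sqr_wseminorm//.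
  have -> : wform W d = re (inner (W (x + s n)) d - inner (W (x + s m)) d).
    by rewrite -innerBl -(linB lW) opprD addrACA subrr add0r.
  apply: le_trans (re_le_rnorm _) _; apply: le_trans (rnormD _ _) _.
  rewrite rnormN mulrDl lerD//; [exact: (hs n).2|exact: (hs m).2].
have small (e : R) : 0 < e -> exists N, forall n, (N <= n)%N -> n.+1%:R^-1 <= e.
  move=> e0; exists (Num.truncn e^-1) => n Nn.
  rewrite invf_ple ?posrE//; apply: ltW; apply: lt_le_trans (truncnS_gt _) _.
  by rewrite ler_nat.
have [|z hz] := @complete_cvg_seq _ H (fun n => W (x + s n)).
  move=> e e0; have M1 : 0 < 2 * (M + 1) by lra.
  have [N hN] := small _ (divr_gt0 e0 M1); exists N => n m Nn Nm.
  apply: le_trans (close n m) _.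
  have := hN n Nn; have := hN m Nm; rewrite !ler_pdivlMr//.
  have : 0 <= n.+1%:R^-1 :> R by []; have : 0 <= m.+1%:R^-1 :> R by [].
  by move: n.+1%:R^-1 m.+1%:R^-1 => a b; lra.
exists z => e e0; have [N hN] := small e e0; have [N' hN'] := hz e e0.
exists (s (maxn N N')); first exact: (hs _).1.
split; first by apply: hN'; rewrite leq_maxr.
move=> t St; apply: le_trans ((hs _).2 t St) _.
by rewrite ler_wpM2r ?wseminorm_ge0//; apply: hN; rewrite leq_maxl.
Qed.

Lemma wresidual_op : exists2 Z, bounded_ops Z & forall x, wresidual W S x (Z x).
Proof.
have [Z hZ] := choice wresidual_exists; exists Z => //.
have [M M0 hM] := psd_bounds psdW; apply/bounded_opsP; split.
  by move=> a u v; apply: wresidual_uniq (hZ _) _; exact: wresidual_lin.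
exists (2 * M ^+ 2); first by rewrite mulr_ge0// sqr_ge0.
by move=> x; exact: wresidual_bound M0 hM (hZ x).
Qed.

End Theory.
End WeightedResidual.

(** * Uniform boundedness, adjoints and factorization *)

Section UniformBoundedness.
Context {R : realType} {V : completeNormedModType R[i]} {I : Type}.
Variables (P : I -> Prop) (f : I -> V -> R[i]).
Hypothesis fL : forall i a x y, f i (a *: x + y) = a * f i x + f i y.
Hypothesis fB : forall i, P i ->
  exists2 K : R, 0 <= K & forall x, rnorm (f i x) <= K * rnorm x.

Let fD i x y : f i (x + y) = f i x + f i y.
Proof. by rewrite -[x]scale1r fL mul1r scale1r. Qed.

Let f0 i : f i 0 = 0.
Proof. by apply: (addrI (f i 0)); rewrite -fD !addr0. Qed.

Let fZ i a x : f i (a *: x) = a * f i x.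
Proof. by rewrite -[a *: x]addr0 fL f0 addr0. Qed.

(** Rescale [y] to a vector [v] of norm [r] and write [f i v = f i (x + v) - f i x]. *)
Lemma locally_bounded (x : V) (r M : R) : 0 < r ->
  (forall i y, P i -> rnorm (y - x) <= r -> rnorm (f i y) <= M) ->
  forall i y, P i -> rnorm (f i y) <= 2 * M / r * rnorm y.
Proof.
move=> r0 hM i y Pi.
have [/rnorm_eq0 ->|y0] := eqVneq (rnorm y) 0.
  by rewrite f0 !rnorm0 mulr0.
have {y0}y0 : 0 < rnorm y by rewrite lt_def y0 rnorm_ge0.
set v := (r / rnorm y)%:C *: y.
have vr : rnorm v = r.
  by rewrite rnormZ rnorm_real ger0_norm ?divfK ?gt_eqF// divr_ge0// ltW.
have h1 : rnorm (f i (x + v)) <= M.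
  by apply: hM => //; rewrite addrC addKr vr.
have h2 : rnorm (f i x) <= M by apply: hM => //; rewrite subrr rnorm0 ltW.
have h3 : rnorm (f i v) <= 2 * M.
  have -> : f i v = f i (x + v) - f i x by rewrite fD addrC addKr.
  by apply: le_trans (rnormD _ _) _; rewrite rnormN; lra.
move: h3; rewrite fZ rnormM rnorm_real ger0_norm; last first.
  by rewrite divr_ge0// ltW.
have -> : r / rnorm y * rnorm (f i y) = rnorm (f i y) * r / rnorm y.
  by field; lra.
by rewrite ler_pdivrMr// -ler_pdivlMr// [X in _ <= X -> _]mulrAC.
Qed.

(* If the conclusion fails, every ball contains a smaller one, of at most half
   its radius, on which some [f i] exceeds a prescribed [n]; the nested balls
   then meet in a point at which the family is unbounded. *)
Theorem uniform_boundedness :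
  (forall x, exists M : R, forall i, P i -> rnorm (f i x) <= M) ->
  exists2 M : R, 0 <= M & forall i x, P i -> rnorm (f i x) <= M * rnorm x.
Proof.
move=> hpt; apply: contrapT => hn.
(* The guard on the radius stands under the existential so that choice yields a total function. *)
have step (n : nat) (xr : V * R) : exists yr : V * R, 0 < xr.2 ->
    [/\ 0 < yr.2, yr.2 <= xr.2 / 2, rnorm (yr.1 - xr.1) <= xr.2 / 2 &
      exists2 i, P i & forall z,
        rnorm (z - yr.1) <= yr.2 -> n%:R <= rnorm (f i z)].
  case: xr => x r /=; have [r0|] := boolP (0 < r); last first.
    by move=> /negP r0; exists (x, r).
  have r2 : 0 < r / 2 by rewrite divr_gt0.
  (* Otherwise the family is bounded by [n.+1] on a ball, and [locally_bounded] gives the conclusion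
     denied by [hn]. *)
  have [i [y [Pi xy fy]]] : exists i y,
      [/\ P i, rnorm (y - x) <= r / 2 & n.+1%:R < rnorm (f i y)].
    apply: contrapT => h; apply: hn.
    have hM i y : P i -> rnorm (y - x) <= r / 2 -> rnorm (f i y) <= n.+1%:R.
      by move=> Pi xy; rewrite leNgt; apply/negP => fy; apply: h; exists i, y.
    exists (2 * n.+1%:R / (r / 2)); first by rewrite divr_ge0// ltW.
    by move=> i y Pi; exact: locally_bounded r2 hM _ _ Pi.
  have [K K0 hK] := fB Pi.
  (* Within distance [(K + 1)^-1] of [y], [f i] varies by at most 1, which brings [n.+1] down to
     [n]. *)
  pose d := Num.min (r / 2) (K + 1)^-1.
  have d0 : 0 < d by rewrite lt_min r2 invr_gt0 ltr_wpDl.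
  exists (y, d) => _; split=> //=; first by rewrite ge_min lexx.
  exists i => // z zy.
  have h : rnorm (f i y) <= rnorm (f i z) + rnorm (f i (y - z)).
    by apply: le_trans (rnormD _ _); rewrite -fD addrC subrK.
  have h2 : rnorm (f i (y - z)) <= 1.
    apply: le_trans (hK _) _; rewrite rnormBC.
    have : rnorm (z - y) * (K + 1) <= 1.
      rewrite -ler_pdivlMr ?ltr_wpDl// div1r; apply: le_trans zy _.
      by rewrite ge_min lexx orbT.
    by have := rnorm_ge0 (z - y); lra.
  by move: fy; rewrite -natr1; lra.
have [next hnext] := choice (fun nx : nat * (V * R) => step nx.1 nx.2).
pose b := fix b n := if n is m.+1 then next (m, b m) else (0 : V, 1 : R).
have b0 n : 0 < (b n).2.
  by elim: n => [|n IH] /=; [exact: ltr01|case: (hnext (n, b n) IH)].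
have hb n := hnext (n, b n) (b0 n).
(* Including the last radius makes the induction work: each step moves the centre by at most half
   the radius and at least halves the radius. *)
have nested n k :
    rnorm ((b (n + k)%N).1 - (b n).1) + (b (n + k)%N).2 <= (b n).2.
  elim: k => [|k IH]; first by rewrite addn0 subrr rnorm0 add0r.
  rewrite addnS /=; have [_ h1 h2 _] := hb (n + k)%N.
  have := rnormD ((next ((n + k)%N, b (n + k)%N)).1 - (b (n + k)%N).1)
                 ((b (n + k)%N).1 - (b n).1).
  by rewrite addrA subrK; move: h1 h2 => /=; lra.
have dist n m : (n <= m)%N -> rnorm ((b m).1 - (b n).1) <= (b n).2.
  move=> /subnKC <-; have := nested n (m - n)%N.
  by have := b0 (n + (m - n))%N; lra.
have rad n : (b n).2 <= 2^-1 ^+ n.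
  elim: n => [|n IH]; first by rewrite expr0.
  by have [_ h _ _] := hb n; apply: le_trans h _; rewrite exprS mulrC ler_wpM2l.
have radlim (e : R) : 0 < e -> exists N, (b N).2 <= e.
  move=> e0; exists (Num.truncn e^-1); apply: le_trans (rad _) _.
  rewrite exprVn invf_ple ?posrE ?exprn_gt0//.
  apply: ltW; apply: lt_le_trans (truncnS_gt _) _.
  by rewrite -natrX ler_nat ltn_expl.
have [|x hx] := @complete_cvg_seq _ V (fun n => (b n).1).
  move=> e e0; have [N hN] := radlim (e / 2) (divr_gt0 e0 (ltr0n _ 2)).
  exists N => n m Nn Nm.
  have -> : (b n).1 - (b m).1 = ((b n).1 - (b N).1) - ((b m).1 - (b N).1).
    by rewrite opprB addrA subrK.
  apply: le_trans (rnormD _ _) _; rewrite rnormN.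
  by have := dist _ _ Nn; have := dist _ _ Nm; lra.
have xin n : rnorm (x - (b n).1) <= (b n).2.
  apply: (@ler_eps_lin _ _ _ 1) => e e0 _; have [N hN] := hx e e0.
  have := hN (maxn n N) (leq_maxr _ _).
  have := dist n (maxn n N) (leq_maxl _ _).
  have := rnormD (x - (b (maxn n N)).1) ((b (maxn n N)).1 - (b n).1).
  by rewrite addrA subrK [rnorm (x - _)]rnormBC; lra.
have [M hM] := hpt x.
(* [N] exceeds [M], while some [f i] is at least [N] on the ball of index [N.+1], which contains
   [x]. *)
pose N := (Num.truncn M).+1; have [_ _ _ [i Pi hi]] := hb N.
have /= := hi x (xin N.+1); rewrite /N.
by have := hM i Pi; have := truncnS_gt M; lra.
Qed.

End UniformBoundedness.

(** * Orthogonal projection, Riesz representation, adjoints and Douglas factorization *)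

Section HilbertSpace.
Context {R : realType} {H : hilbertType R}.
Implicit Types (S : set H) (T : H -> H) (x y z s t : H).

Lemma psd_id : psd_ops (idfun : H -> H).
Proof.
split; last by move=> x; rewrite inner_norm exprn_ge0.
by split=> //; exists 1 => x; rewrite mul1r.
Qed.

(** For [W = 1], [Z] is the orthogonal projection onto the orthogonal complement of [S]; the last
    clause puts [x - Z x] in the closure of [S]. *)
Lemma orthogonal_residual S : subspace S ->
  exists2 Z : H -> H, bounded_ops Z & forall x,
    (forall t, S t -> inner (Z x) t = 0) /\
    (forall e : R, 0 < e -> exists2 s, S s & rnorm (x - Z x - s) <= e).
Proof.
move=> subS; have [Z bZ hZ] := wresidual_op psd_id subS.
exists Z => // x; split=> [t St|e e0].
  exact: wresidual_orth (hZ x) St.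
have [s Ss [sz _]] := hZ x e e0; exists (- s); first exact: subspaceN.
by rewrite opprK addrAC.
Qed.

Lemma bounded_approx0 (V : normedModType R[i]) (g : H -> V) (M : R) S x :
  linear g -> 0 <= M -> (forall x, rnorm (g x) <= M * rnorm x) ->
  (forall s, S s -> g s = 0) ->
  (forall e : R, 0 < e -> exists2 s, S s & rnorm (x - s) <= e) -> g x = 0.
Proof.
move=> lg M0 gM gS hx; apply: rnorm_eq0; apply/eqP.
rewrite eq_le rnorm_ge0 andbT.
apply: (@ler_eps_lin _ _ _ M) => e e0 _; have [s Ss xs] := hx e e0.
rewrite add0r mulrC -[g x]subr0 -(gS s Ss) -(linB lg).
by apply: le_trans (gM _) _; rewrite ler_wpM2l.
Qed.

(** If [f x] is nonzero, the component [z] of [x] orthogonal to the kernel has [f z = f x]. Each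
    [y - (f y / f z) *: z] is in the kernel, hence orthogonal to [z], which determines [f y]. *)
Theorem Riesz (f : H -> R[i]) (M : R) : 0 <= M ->
  (forall a x y, f (a *: x + y) = a * f x + f y) ->
  (forall x, rnorm (f x) <= M * rnorm x) ->
  exists z, forall x, f x = inner x z.
Proof.
move=> M0 fL fM.
have lf : linear (f : H -> R[i]^o) by move=> a x y; exact: fL.
have subS := subspace_ker lf.
have [[x fx]|h] := pselect (exists x, f x != 0); last first.
  exists 0 => x; rewrite inner0r; apply/eqP; apply: contrapT => fx.
  by apply: h; exists x; apply/negP.
have [Z _ /(_ x)[Zo Zc]] := orthogonal_residual subS; set z := Z x in Zo Zc.
have fxz : f (x - z) = 0 by apply: (bounded_approx0 lf M0 fM _ Zc).
have fz : f z != 0.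
  by move: fxz; rewrite (linB lf) => /eqP; rewrite subr_eq0 => /eqP <-.
have zz : inner z z != 0.
  by apply: contra_neq fz => /inner_eq0 ->; exact: (lin0 lf).
exists ((f z / inner z z)^* *: z) => y.
rewrite innerZr conjCK; have : inner (y - (f y / f z) *: z) z = 0.
  rewrite innerC Zo ?rmorph0//= (linB lf) (linZ lf) /=.
  by rewrite /GRing.scale /= divfK// subrr.
rewrite innerBl innerZl => /eqP; rewrite subr_eq0 => /eqP ->.
by field; rewrite fz zz.
Qed.

(** Riesz' theorem gives the adjoint [S] pointwise; it is bounded because
    [|S y|^2 = <T (S y), y> <= M |S y| |y|]. *)
Lemma adjointP T : bounded_ops T -> bounded_ops (adjoint T) /\
  forall x y, inner (T x) y = inner x (adjoint T y).
Proof.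
move=> bT; apply: (@xgetPex _ (cst 0) [set G | bounded_ops G /\
  forall x y, inner (T x) y = inner x (G y)]).
have /bounded_opsP[lT [M M0 TM]] := bT.
have bnd x y : rnorm (inner (T x) y) <= M * rnorm y * rnorm x.
  apply: le_trans (rnorm_inner _ _) _; rewrite mulrAC.
  by rewrite ler_wpM2r ?rnorm_ge0.
have /choice[S hS] y : exists z, forall x, inner (T x) y = inner x z.
  apply: Riesz (bnd ^~ y); first by rewrite mulr_ge0 ?rnorm_ge0.
  by move=> a u v; rewrite lT innerDl innerZl.
exists S; split=> [|x y]; last exact: hS.
apply/bounded_opsP; split.
  move=> a u v; apply: inner_inj => z; rewrite innerC -hS innerDr innerZr !hS.
  by rewrite rmorphD rmorphM /= conjCK -!innerC innerDl innerZl.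
exists M => // y; have [->|y0] := eqVneq (rnorm (S y)) 0.
  by rewrite mulr_ge0 ?rnorm_ge0.
have {y0}y0 : 0 < rnorm (S y) by rewrite lt_def y0 rnorm_ge0.
rewrite -(ler_pM2r y0) -expr2; have := bnd (S y) y.
by rewrite hS inner_rnorm rnorm_real ger0_norm ?sqr_ge0.
Qed.

(* Douglas' lemma, without the bound on the norm of the factor. *)
Theorem Douglas_factorization (S T : H -> H) : bounded_ops S -> bounded_ops T ->
  (forall x, exists y, S x = T y) ->
  exists2 G : H -> H, bounded_ops G & forall x, T (G x) = S x.
Proof.
move=> bS bT ST.
have [/bounded_opsP[lS [N N0 SN]] /bounded_opsP[lT [M M0 TM]]] := (bS, bT).
have [/bounded_opsP[lA _] adjT] := adjointP bT; set A := adjoint T in lA adjT.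
have subN := subspace_ker lT.
have [Z bZ hZ] := orthogonal_residual subN.
have TZ y : T (Z y) = T y.
  have /eqP : T (y - Z y) = 0 by apply: (bounded_approx0 lT M0 TM _ (hZ y).2).
  by rewrite (linB lT) subr_eq0 => /eqP.
(* An arbitrary preimage is projected onto the orthogonal complement of the kernel of [T], which
   makes it canonical. *)
have [Y hY] := choice ST; pose G := Z \o Y.
have TG x : T (G x) = S x by rewrite /G /= TZ hY.
have Gorth x t : T t = 0 -> inner (G x) t = 0 by exact: (hZ (Y x)).1.
(* The defect of linearity lies in the kernel of [T] and is orthogonal to it. *)
have lG : linear G.
  move=> a u v; apply/eqP; rewrite -subr_eq0; apply/eqP/inner_eq0.
  set d := G _ - _; have Td : T d = 0.
    by rewrite (linB lT) lT !TG lS subrr.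
  by rewrite {1}/d innerBl innerDl innerZl !Gorth// mulr0 addr0 subrr.
have Gw x w : inner (G x) (A w) = inner (S x) w by rewrite -adjT TG.
(* [G x] lies in the closure of the range of the adjoint, and the functionals
   [x |-> <G x, A w>], for [A w] in the unit ball, are bounded since
   [<G x, A w> = <S x, w>]; they are pointwise bounded by [|G x|]. *)
have [|w|x|K K0 GK] := @uniform_boundedness _ H H
  (fun w => rnorm (A w) <= 1) (fun w x => inner (G x) (A w)).
- by move=> w a x y; rewrite lG innerDl innerZl.
- exists (N * rnorm w) => [|x]; first by rewrite mulr_ge0 ?rnorm_ge0.
  rewrite Gw; apply: le_trans (rnorm_inner _ _) _.
  by rewrite mulrAC ler_wpM2r ?rnorm_ge0.
- exists (rnorm (G x)) => w Aw; apply: le_trans (rnorm_inner _ _) _.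
  by rewrite ler_piMr ?rnorm_ge0.
have GA x w : rnorm (inner (G x) (A w)) <= K * rnorm x * rnorm (A w).
  have [/rnorm_eq0 ->|Aw] := eqVneq (rnorm (A w)) 0.
    by rewrite inner0r !rnorm0 mulr0.
  have {Aw}Aw : 0 < rnorm (A w) by rewrite lt_def Aw rnorm_ge0.
  set r := rnorm (A w) in Aw *; have r1 : 0 <= r^-1 by rewrite invr_ge0 ltW.
  have := GK (r^-1%:C *: w) x; rewrite (linZ lA) innerZr.
  rewrite rnormZ rnormM rnorm_conj.
  rewrite rnorm_real ger0_norm// mulVf ?gt_eqF// => /(_ (lexx _)).
  by rewrite mulrC ler_pdivrMr.
(* The component of [G x] orthogonal to [range A] is in the kernel of [T], hence orthogonal to
   [G x], and so vanishes. *)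
have dense x (e : R) : 0 < e -> exists2 s, range A s & rnorm (G x - s) <= e.
  have [Z' _ /(_ (G x))[zo zc]] := orthogonal_residual (subspace_range lA).
  suff z0 : Z' (G x) = 0 by move: zc; rewrite z0 subr0; exact.
  have Tz : T (Z' (G x)) = 0.
    by apply: inner_eq0; rewrite adjT zo//; exists (T (Z' (G x))).
  apply: inner_eq0; rewrite -[X in inner X _](subKr (G x)).
  rewrite innerBl Gorth// sub0r.
  apply/eqP; rewrite oppr_eq0; apply/eqP.
  have lz : linear (fun v => inner v (Z' (G x)) : R[i]^o).
    by move=> a u v; rewrite innerDl innerZl.
  apply: (bounded_approx0 lz (rnorm_ge0 (Z' (G x))) _ _ zc).
  - by move=> u; apply: le_trans (rnorm_inner _ _) _; rewrite mulrC.
  - by move=> s As; rewrite innerC zo// rmorph0.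
exists G => //; apply/bounded_opsP; split=> //; exists K => // x.
have [->|g0] := eqVneq (rnorm (G x)) 0; first by rewrite mulr_ge0 ?rnorm_ge0.
have {g0}g0 : 0 < rnorm (G x) by rewrite lt_def g0 rnorm_ge0.
rewrite -(ler_pM2r g0) -expr2.
(* Replacing one [G x] in [<G x, G x>] by a nearby [A w] gives [|G x|^2 <= K |x| |G x|] up to order
   [e]. *)
apply: (@ler_eps_lin _ _ _ (rnorm (G x) + K * rnorm x)) => e e0 _.
have [_ [w _ <-] Gs] := dense x e e0.
have -> : rnorm (G x) ^+ 2 = rnorm (inner (G x) (G x)).
  by rewrite inner_rnorm rnorm_real ger0_norm ?sqr_ge0.
have -> : inner (G x) (G x) = inner (G x) (A w) + inner (G x) (G x - A w).
  by rewrite innerBr addrC subrK.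
apply: le_trans (rnormD _ _) _.
have h1 := GA x w; have h2 := rnorm_inner (G x) (G x - A w).
have h3 : rnorm (G x) * rnorm (G x - A w) <= rnorm (G x) * e.
  by rewrite ler_wpM2l ?rnorm_ge0.
have h4 : K * rnorm x * rnorm (A w) <= K * rnorm x * (rnorm (G x) + e).
  rewrite ler_wpM2l ?mulr_ge0 ?rnorm_ge0//.
  have := rnormD (G x) (- (G x - A w)); rewrite rnormN opprB addrC subrK; lra.
by lra.
Qed.

End HilbertSpace.

(** * Shorted operators and least squares *)

Section OperatorOrder.
Context {R : realType} {H : hilbertType R}.
Implicit Types (S T W X : H -> H) (U : set H).

Lemma bounded_ops_comp S T :
  bounded_ops S -> bounded_ops T -> bounded_ops (S \o T).
Proof.
move=> /bounded_opsP[lS [M M0 SM]] /bounded_opsP[lT [N N0 TN]].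
apply/bounded_opsP; split; first by move=> a u v /=; rewrite lT lS.
exists (M * N) => [|x /=]; first by rewrite mulr_ge0.
by apply: le_trans (SM _) _; rewrite -mulrA ler_wpM2l.
Qed.

Lemma bounded_opsD S T :
  bounded_ops S -> bounded_ops T -> bounded_ops (S \+ T).
Proof.
move=> /bounded_opsP[lS [M M0 SM]] /bounded_opsP[lT [N N0 TN]].
apply/bounded_opsP; split.
  by move=> a u v /=; rewrite lT lS scalerDr addrACA.
exists (M + N) => [|x /=]; first by rewrite addr_ge0.
by apply: le_trans (rnormD _ _) _; rewrite mulrDl lerD.
Qed.

Lemma bounded_opsB S T :
  bounded_ops S -> bounded_ops T -> bounded_ops (S \- T).
Proof.
move=> bS /bounded_opsP[lT [N N0 TN]]; apply: (bounded_opsD bS).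
apply/bounded_opsP; split; first by move=> a u v; rewrite lT opprD scalerN.
by exists N => // x; rewrite rnormN.
Qed.

Lemma bounded_ops_rank1 (b w : H) : bounded_ops (fun v => inner v b *: w).
Proof.
apply/bounded_opsP; split.
  by move=> a u v; rewrite innerDl innerZl scalerDl scalerA.
exists (rnorm b * rnorm w) => [|x]; first by rewrite mulr_ge0 ?rnorm_ge0.
rewrite rnormZ mulrAC ler_wpM2r ?rnorm_ge0//.
by apply: le_trans (rnorm_inner _ _) _; rewrite mulrC.
Qed.

(** The form of the difference [D] vanishes, and Cauchy-Schwarz for [D] then gives
    [|D x|^2 <= 0]. *)
Lemma op_le_anti S T : op_le S T -> op_le T S -> S = T.
Proof.
move=> [[lD _] pD] [_ pN]; apply/funext => x; apply/esym/eqP.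
rewrite -subr_eq0; apply/eqP/inner_eq0.
have D0 : wform (T \- S) x = 0.
  apply/eqP; rewrite eq_le wform_ge0// andbT.
  have := ge0_re (pN x); rewrite /wform /= !innerBl !reD !reN; lra.
apply: rnorm_eq0; apply/eqP; rewrite eq_le rnorm_ge0 andbT.
have := psd_Cauchy_Schwarz lD pD x ((T \- S) x).
by rewrite {1}/wseminorm D0 sqrtr0 mul0r.
Qed.

Lemma op_leP S T : bounded_ops S -> bounded_ops T ->
  op_le S T <-> forall x, inner (S x) x <= inner (T x) x.
Proof.
move=> bS bT; split=> [[_ h] x|h].
  by have := h x; rewrite innerBl subr_ge0.
by split=> [|x]; [exact: bounded_opsB|rewrite innerBl subr_ge0].
Qed.

Lemma bounded_ops0 : bounded_ops (cst 0 : H -> H).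
Proof.
split; first by move=> a u v /=; rewrite scaler0 addr0.
by exists 0 => x; rewrite /cst normr0 mul0r.
Qed.

(** The residual operator [Z] is the maximum. A competitor [X] has range orthogonal to [U], so [<X
    x, x> = <X (x + s), x + s> <= wform W (x + s)] for [s] in [U], and the infimum of the right side
    is [<Z x, x>]. *)
Theorem shortedP W U : psd_ops W -> subspace U ->
  bounded_ops (shorted W U) /\ forall x, wresidual W U x (shorted W U x).
Proof.
move=> psdW subU; have [bW pW] := psdW; have [lW _] := bW.
have [Z bZ hZ] := wresidual_op psdW subU.
set E := [set X | [/\ bounded_ops X, op_le (cst 0) X, op_le X W
                    & range X `<=` orthogonal_compl U]].
have maxZ : is_max_op E Z.
  split.
    split=> //.
    - apply/op_leP => //; first exact: bounded_ops0.
      by move=> x; rewrite inner0l; exact: wresidual_ge0 (hZ x).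
    - apply/op_leP => // x.
      rewrite (ge0_complexE (wresidual_ge0 psdW subU (hZ x))) (wformE pW) lecR.
      by have := wresidual_le psdW subU (hZ x) subU.1; rewrite addr0.
    - by move=> _ [x _ <-] t Ut; exact: wresidual_orth (hZ x) Ut.
  move=> X [bX /(op_leP bounded_ops0 bX) X0 /(op_leP bX bW) XW XU].
  have pX x : 0 <= inner (X x) x by have := X0 x; rewrite inner0l.
  have [lX _] := bX.
  apply/op_leP => // x.
  rewrite (ge0_complexE (wresidual_ge0 psdW subU (hZ x))) (wformE pX) lecR.
  apply: (@ler_eps_lin _ _ _ 1) => e e0 _; rewrite mulr1.
  have [s Us hs] := wresidual_adherent psdW subU e0 (hZ x).
  apply: le_trans hs.
  have Xs y : inner (X y) s = 0 by apply: XU => //; exists y.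
  have -> : wform X x = wform X (x + s).
    by rewrite wformD// Xs {3}/wform Xs /= mulr0 !addr0.
  by rewrite -lecR -!wformE.
have [max1 max2] : is_max_op E (shorted W U).
  by apply: xgetPex; exists Z.
suff -> : shorted W U = Z by [].
by apply: op_le_anti; [exact: maxZ.2|apply: max2; exact: maxZ.1].
Qed.

End OperatorOrder.

(** * The least squares problem and its normal equation *)

Section LeastSquares.
Context {R : realType} {H : hilbertType R}.
Variables (A B C W : H -> H).
Hypotheses (bA : bounded_ops A) (bB : bounded_ops B) (bC : bounded_ops C).
Hypothesis psdW : psd_ops W.
Implicit Types (X Y : H -> H) (x y z : H).

Definition residual_op X : H -> H := (A \o X \o B) \- C.
Definition residual_form X : H -> H :=
  adjoint (residual_op X) \o W \o residual_op X.
Let lA : linear A. Proof. by case: bA. Qed.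
Let lB : linear B. Proof. by case: bB. Qed.
Let lC : linear C. Proof. by case: bC. Qed.
Let bW : bounded_ops W. Proof. by case: psdW. Qed.
Let lW : linear W. Proof. by case: bW. Qed.
Let pW : forall x, 0 <= inner (W x) x. Proof. by case: psdW. Qed.

(** Exact minimality is near-minimality with error 0; conversely, the cross term of [wformD]
    vanishes. *)
Lemma wform_min_range u :
  (forall z, wform W u <= wform W (u + A z)) <->
  (forall y, inner (W u) (A y) = 0).
Proof.
split=> [h y|h z]; last by rewrite wformD// h mulr0 addr0 lerDl wform_ge0.
apply: rnorm_eq0; apply/eqP; rewrite -sqrf_eq0 eq_le sqr_ge0 andbT.
rewrite -(mul0r (wform W (A y))); apply: near_min_inner => // a.
by rewrite addr0 -(linZ lA).
Qed.

(** The normal equation in weak form, free of adjoints. *)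
Definition normal_solution X :=
  forall x y, inner (W (A (X (B x)) - C x)) (A y) = 0.

Lemma normal_equation X :
  adjoint A \o W \o residual_op X = cst 0 <-> normal_solution X.
Proof.
have [_ adjA] := adjointP bA; split=> [h x y|h].
  rewrite innerC adjA; have := congr1 (@^~ x) h; rewrite /= => ->.
  by rewrite inner0r rmorph0.
apply/funext => x; apply: inner_eq0; rewrite -adjA innerC.
by rewrite [inner _ _]h rmorph0.
Qed.

Lemma bounded_residual_op X : bounded_ops X -> bounded_ops (residual_op X).
Proof.
move=> bX; apply: bounded_opsB => //.
by apply: bounded_ops_comp => //; exact: bounded_ops_comp.
Qed.

Lemma inner_residual_form X x y : bounded_ops X ->
  inner (residual_form X x) y = inner (W (residual_op X x)) (residual_op X y).
Proof.
move=> /bounded_residual_op/adjointP[_ adjX].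
by rewrite innerC -adjX -innerC.
Qed.

Lemma bounded_residual_form X : bounded_ops X -> bounded_ops (residual_form X).
Proof.
move=> bX; have bR := bounded_residual_op bX.
have [bR' _] := adjointP bR.
by apply: bounded_ops_comp => //; exact: bounded_ops_comp.
Qed.

Lemma residual_form_leP X Y : bounded_ops X -> bounded_ops Y ->
  op_le (residual_form X) (residual_form Y) <->
  forall x, wform W (A (X (B x)) - C x) <= wform W (A (Y (B x)) - C x).
Proof.
move=> /[dup] bX /bounded_residual_form bFX.
move=> /[dup] bY /bounded_residual_form bFY; rewrite op_leP//.
by split=> h x; have := h x; rewrite !inner_residual_form// !wformE// lecR.
Qed.

(* When [B x <> 0], rank-one perturbations of [X] move [X (B x)] to an arbitrary
   vector; the vectors with [B x = 0] follow by additivity, since [B <> 0]. *)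
Lemma residual_form_minP X : B <> cst 0 -> bounded_ops X ->
  (forall Y, bounded_ops Y -> op_le (residual_form X) (residual_form Y)) <->
  normal_solution X.
Proof.
move=> B0 bX; have [lX _] := bX; split=> [h|h Y bY]; last first.
  apply/residual_form_leP => // x; have /wform_min_range := h x.
  move=> /(_ (Y (B x) - X (B x))); rewrite (linB lA) addrAC.
  by rewrite subrKC.
have key x y : B x != 0 -> inner (W (A (X (B x)) - C x)) (A y) = 0.
  move=> Bx; move: y; apply/wform_min_range => z.
  (* Normalized so that [Y (B x) = X (B x) + z]. *)
  pose Y := X \+ (fun v => inner v (B x) *: ((inner (B x) (B x))^-1 *: z)).
  have bY : bounded_ops Y.
    by apply: bounded_opsD => //; exact: bounded_ops_rank1.
  have /(residual_form_leP bX bY)/(_ x) := h Y bY.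
  rewrite /Y /= scalerA divff ?scale1r; last first.
    by apply: contra_neq Bx => /inner_eq0.
  by rewrite (linD lA) addrAC.
have [x0 Bx0] : exists x, B x != 0.
  apply: contrapT => hB; apply: B0; apply/funext => x /=; apply/eqP.
  by apply: contrapT => /negP Bx; apply: hB; exists x.
move=> x y; have [Bx|Bx] := eqVneq (B x) 0; last exact: key.
have h1 := key x0 y Bx0; have := key (x0 + x) y.
rewrite !(linD lB, linD lX, linD lA, linD lC) Bx addr0 => /(_ Bx0).
rewrite !(lin0 lX) !(lin0 lA) addr0 sub0r opprD addrA (linD lW) innerDl.
by rewrite h1 add0r.
Qed.

(** The first inclusion puts [A^* W C x] in the range of [A^* W A], since [A^*] kills [W v] for [v]
    in the [W]-orthogonal complement of [R(A)]; Douglas' lemma then provides [G]. *)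
Lemma normal_solution_exists : closed (range B) ->
  (range C `<=` set_add (range A) (worthogonal_compl W (range A)) /\
   nullspace B `<=` nullspace (adjoint A \o W \o C)) <->
  exists2 X, bounded_ops X & normal_solution X.
Proof.
move=> clB; have [bA' adjA] := adjointP bA; set A' := adjoint A in bA' adjA *.
have [lA' _] := bA'; split=> [[rC nB]|[X bX hX]]; last first.
  split=> [_ [x _ <-]|x Bx].
    exists (A (X (B x))); first by exists (X (B x)).
    exists (C x - A (X (B x))); last by rewrite addrC subrK.
    move=> _ [y _ <-]; rewrite -opprB (linN lW) innerNl hX oppr0.
    by [].
  rewrite /nullspace /=; apply: inner_eq0; rewrite -adjA innerC.
  have := hX x (A' (W (C x))).
  rewrite [B x]Bx (lin0 bX.1) (lin0 lA) sub0r (linN lW) innerNl => /eqP.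
  by rewrite oppr_eq0 => /eqP ->; rewrite rmorph0.
have [||x|G bG hG] := @Douglas_factorization _ _ (A' \o W \o C) (A' \o W \o A).
- by apply: bounded_ops_comp => //; exact: bounded_ops_comp.
- by apply: bounded_ops_comp => //; exact: bounded_ops_comp.
- have [|_ [y _ <-] [v hv Cx]] := rC (C x); first by exists x.
  exists y; rewrite /= -Cx (linD lW) (linD lA').
  suff -> : A' (W v) = 0 by rewrite addr0.
  by apply: inner_eq0; rewrite -adjA innerC hv ?rmorph0//; exists (A' (W v)).
(* [idfun \- Z] projects onto the closed range of [B]; factoring it through [B] gives a bounded [D]
   with [B D B = B]. *)
have [Z bZ hZ] := orthogonal_residual (subspace_range lB).
have [||x|D bD hD] := @Douglas_factorization _ _ (idfun \- Z) B => //.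
- by apply: bounded_opsB => //; case: (@psd_id R H).
- have [y _ By] : range B (x - Z x) by apply: closed_approx clB (hZ x).2.
  by exists y; rewrite By.
have BDB x : B (D (B x)) = B x.
  rewrite hD /=; suff -> : Z (B x) = 0 by rewrite subr0.
  apply: inner_eq0; have [y _ Zy] : range B (B x - Z (B x)).
    exact: closed_approx clB (hZ (B x)).2.
  have Zx : Z (B x) = B x - B y by rewrite Zy subKr.
  by rewrite {2}Zx innerBr !(hZ (B x)).1 ?subrr.
exists (G \o D) => [|x y]; first exact: bounded_ops_comp.
(* What remains is [A^* W C] at [D (B x) - x], a vector of the nullspace of [B]. *)
rewrite innerC adjA (linB lW) (linB lA') [A' (W (A _))]hG /= -!(linB lA').
rewrite -(linB lW) -(linB lC) [A' _]nB ?inner0r ?rmorph0//.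
by rewrite /nullspace /= (linB lB) BDB subrr.
Qed.

Lemma residual_form_shorted X : bounded_ops X -> normal_solution X ->
  adjoint C \o shorted W (range A) \o C = residual_form X.
Proof.
move=> bX hX; have [_ hS] := shortedP psdW (subspace_range lA).
have [_ adjC] := adjointP bC.
apply/funext => x; apply: inner_inj => y; rewrite inner_residual_form//.
have -> : inner ((adjoint C \o shorted W (range A) \o C) x) y =
          inner (shorted W (range A) (C x)) (C y).
  by rewrite /= innerC -adjC -innerC.
have -> : shorted W (range A) (C x) = - W (residual_op X x).
  rewrite -(linN lW) opprB; apply: wresidual_uniq (hS _) _ => //.
    exact: subspace_range.
  rewrite -(linN lA); apply: wresidual_exact; first by exists (- X (B x)).
  move=> _ [z _ <-]; rewrite (linN lA) -opprB (linN lW) innerNl hX oppr0.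
  by [].
(* [W] of the residual is orthogonal to [A (X (B y))], so [- C y] may be replaced by the residual at
   [y]. *)
by rewrite innerNl innerBr hX sub0r.
Qed.

(** Both sides express, for each [x], minimality at [X (B x)]; the competitors differ by the shift
    [z - X (B x)]. *)
Lemma winverseP X : bounded_ops X ->
  normal_solution X <-> is_winverse W A C (X \o B).
Proof.
move=> bX; split=> [h|[_ h] x].
  split=> [|x z]; first exact: bounded_ops_comp.
  rewrite ler_wnorm//; have /wform_min_range := h x.
  move=> /(_ (z - X (B x))); rewrite (linB lA) addrAC.
  by rewrite subrKC.
apply/wform_min_range => z; have := h x (X (B x) + z).
by rewrite ler_wnorm// (linD lA) addrAC.
Qed.

End LeastSquares.

(* [B <> cst 0] is necessary: for B = 0 the operator H(X) = C^* W C does not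
   depend on X, so that [cond_i] holds, while [cond_ii] and [cond_iii] both
   amount to A^* W C = 0. *)
Theorem theorem3p2 (R : realType) (H : hilbertType R) (A B C W : H -> H) :
  separable H ->
  bounded_ops A -> closed (range A) ->
  bounded_ops B -> closed (range B) -> B <> cst 0 ->
  bounded_ops C ->
  psd_ops W ->
  let residual (X : H -> H) : H -> H := (A \o X \o B) \- C in
  let Hop (X : H -> H) : H -> H :=
    adjoint (residual X) \o W \o residual X in
  let cond_i := exists2 X0, bounded_ops X0 &
    forall X, bounded_ops X -> op_le (Hop X0) (Hop X) in
  let cond_ii :=
    range C `<=` set_add (range A) (worthogonal_compl W (range A)) /\
    nullspace B `<=` nullspace (adjoint A \o W \o C) in
  let cond_iii := exists2 X, bounded_ops X &
    adjoint A \o W \o residual X = cst 0 in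
  [/\ cond_i <-> cond_ii,
      cond_ii <-> cond_iii &
      (cond_i \/ cond_ii \/ cond_iii) ->
      is_min_op (Hop @` bounded_ops)
        (adjoint C \o shorted W (range A) \o C) /\
      forall X0, bounded_ops X0 ->
        (is_min_op (Hop @` bounded_ops) (Hop X0) <->
         is_winverse W A C (X0 \o B))].
Proof.
move=> _ bA _ bB clB B0 bC psdW residual Hop cond_i cond_ii cond_iii.
have minP X : bounded_ops X ->
    (forall Y, bounded_ops Y -> op_le (Hop X) (Hop Y)) <->
    normal_solution A B C W X.
  exact: residual_form_minP.
(* Each condition is compared with the existence of a solution of the weak normal equation. *)
have Ei : cond_i <-> exists2 X, bounded_ops X & normal_solution A B C W X.
  by split=> -[X bX hX]; exists X => //; apply/minP.
have Eii : cond_ii <-> exists2 X, bounded_ops X & normal_solution A B C W X.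
  exact: normal_solution_exists.
have Eiii : cond_iii <-> exists2 X, bounded_ops X & normal_solution A B C W X.
  split=> -[X bX hX]; exists X => //.
    exact/normal_equation.
  exact/normal_equation.
split; [by rewrite Ei Eii|by rewrite Eii Eiii|].
rewrite Ei Eii Eiii => hX.
have {hX}[X bX hX] : exists2 X, bounded_ops X & normal_solution A B C W X.
  by case: hX => [|[]].
have minE Y : bounded_ops Y -> is_min_op (Hop @` bounded_ops) (Hop Y) <->
    normal_solution A B C W Y.
  move=> bY; rewrite -minP//; split=> [[_ h] Z bZ|h].
    by apply: h; exists Z.
  by split=> [|_ [Z bZ <-]]; [exists Y|exact: h].
split=> [|Y bY].
  rewrite (residual_form_shorted bA bB bC psdW bX hX).
  exact/minE.
by rewrite minE//; exact: winverseP.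
Qed.
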